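(* Let $M\ge 2$ and let the Cantor set $F$ be generated by a $0$-$1$-vector $(p_0,\dots,p_{M-1})\in\{0,1\}^M$ with $\sum_{k=0}^{M-1}p_k>1$, and let $F_1=F_2=F$. Then $F_2-F_1$ does not contain any intervals if and only if $T_0\in\mathcal{A}$, where $\mathcal{A}$ is the fixed point of the map $G$ reached by iterating $G$ starting from $\{\mathcal{M}(0)^\triangledown,\dots,\mathcal{M}(M-1)^\triangledown\}$.
   Context: Cantor set generated by a $0$-$1$-vector: $F=\bigcap_{n\ge1}\bigcup I_{i_1\dots i_n}$, where for each $n$ the union is over all strings $i_1\dots i_n\in\{0,\dots,M-1\}^n$ with $p_{i_1}=\dots=p_{i_n}=1$, and $I_{i_1\dots i_n}=\big[\sum_{k=1}^n i_kM^{-k},\ \sum_{k=1}^n i_kM^{-k}+M^{-n}\big]$. (This is the case of deterministic labels, so the two ''independent copies'' $F_1,F_2$ both equal $F$.) $F_2-F_1=\{x_2-x_1:x_1\in F_1,x_2\in F_2\}$. ''Interval'' means a nondegenerate interval. Matrices $\mathcal{M}(k)$: let $\varphi(x,y)=\big(\tfrac{x-y}{\sqrt2},\tfrac{x+y-1}{\sqrt2}\big)$, i.e. rotate the unit square by $45^\circ$ in the positive direction and translate it so that its horizontal diagonal becomes $[-\frac12\sqrt2,\frac12\sqrt2]$ on the $x$-axis. Let $Q_{i,j}=\varphi(I_i\times I_j)$; its vertical diagonal divides it into a left triangle $L_{i,j}$ and a right triangle $R_{i,j}$. For $k\in\{0,\dots,M-1\}$ let $C_k=\big(\tfrac12\sqrt2\,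 I_k\big)\times\mathbb{R}$ and $C_k^-=\big(\tfrac12\sqrt2\, I_k-\tfrac12\sqrt2\big)\times\mathbb{R}$. For $V\in\{L,R\}$ let $Z^{LV}(k)$ (respectively $Z^{RV}(k)$) be the number of pairs $(i,j)$ with $p_i=p_j=1$ and $V_{i,j}\subset C_k^-$ (respectively $V_{i,j}\subset C_k$). Put $$\mathcal{M}(k)=\begin{bmatrix} Z^{LL}(k)& Z^{LR}(k)\\ Z^{RL}(k)&Z^{RR}(k)\end{bmatrix}.$$ Explicitly, $Z^{LL}(k),Z^{LR}(k),Z^{RL}(k),Z^{RR}(k)$ are the numbers of pairs $(i,j)\in\{0,\dots,M-1\}^2$ with $p_i=p_j=1$ and $i-j$ equal to $k+1-M$, $k-M$, $k+1$, $k$ respectively. Reduction: for a matrix $A=(a_{ij})$ with non-negative integer entries, $A^\triangledown$ is the matrix with entries $a^\triangledown_{ij}=0$ if $a_{ij}=0$ and $a^\triangledown_{ij}=1$ if $a_{ij}\ge1$. Let $\mathcal{T}$ be the set of $2\times2$ matrices with entries in $\{0,1\}$, and let $T_0\in\mathcal T$ be the zero matrix. Let $2^{\mathcal{T}}$ be the set of subsets of $\mathcal{T}$, and define $G:2^{\mathcal{T}}\to2^{\mathcal{T}}$ by $G(\emptyset)=\emptyset$ and $G(\mathcal{C})=\{(TT')^\triangledown: T\in\mathcal{C},\ T'\in\mathcal{C}\}$ for $\mathcal{C}\neq\emptyset$. As $2^{\mathcal T}$ is finite, every orbit of $G$ is eventually periodic; moreover (as the paper finds by computer) every orbit is eventually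 constant, i.e. ends in a fixed point of $G$. *)

(* Defs.v *)
From mathcomp Require Import all_boot all_order all_algebra.
From mathcomp Require Import all_classical all_reals all_analysis.

Set Implicit Arguments.
Unset Strict Implicit.
Unset Printing Implicit Defensive.

Import Order.TTheory GRing.Theory Num.Theory.

Local Open Scope classical_set_scope.
Local Open Scope ring_scope.

Section CantorSet.
Variables (R : realType) (M : nat) (p : 'I_M -> bool).

(* The string i_1 ... i_n is the tuple s with i_(k+1) = tnth s k. *)
Definition cyl_left (n : nat) (s : n.-tuple 'I_M) : R :=
  \sum_(k < n) (tnth s k)%:R / M%:R ^+ k.+1.

Definition cyl (n : nat) (s : n.-tuple 'I_M) : set R :=
  `[cyl_left s, cyl_left s + (M%:R ^+ n)^-1]%classic.

Definition cantor_set01 : set R :=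
  \bigcap_(n in [set n | (1 <= n)%N])
    \bigcup_(s in [set s : n.-tuple 'I_M | forall k, p (tnth s k)]) cyl s.

End CantorSet.

Arguments cyl_left R {M n} s.
Arguments cyl R {M n} s.
Arguments cantor_set01 R {M} p.

Section Intervals.
Variable R : realType.

Definition algebraic_difference (F2 F1 : set R) : set R :=
  [set x2 - x1 | x2 in F2 & x1 in F1].

Definition contains_interval (A : set R) : Prop :=
  exists J : set R,
    [/\ is_interval J, exists x y, [/\ J x, J y & x < y] & J `<=` A].

End Intervals.

Section CountingMatrices.
Variables (R : realType) (M : nat).

Definition rot (q : R * R) : R * R :=
  ((q.1 - q.2) / Num.sqrt 2, (q.1 + q.2 - 1) / Num.sqrt 2).

Definition level1 (i : 'I_M) : set R := cyl R [tuple i].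

Definition square (i j : 'I_M) : set (R * R) :=
  rot @` (level1 i `*` level1 j).

(* The bottom end point of the vertical diagonal of [square i j]. *)
Definition bottom_vertex (i j : 'I_M) : R * R :=
  rot (cyl_left R [tuple i], cyl_left R [tuple j]).

Inductive side : Type := Left | Right.

(* Both triangles are closed: they share the vertical diagonal. *)
Definition triangle (V : side) (i j : 'I_M) : set (R * R) :=
  match V with
  | Left => square i j `&` [set q | q.1 <= (bottom_vertex i j).1]
  | Right => square i j `&` [set q | (bottom_vertex i j).1 <= q.1]
  end.

(* [column Left k] is C_k^- and [column Right k] is C_k. *)
Definition column (U : side) (k : 'I_M) : set (R * R) :=
  match U with
  | Left =>
      [set Num.sqrt 2 / 2 * x - Num.sqrt 2 / 2 | x in level1 k] `*` setT
  | Right => [set Num.sqrt 2 / 2 * x | x in level1 k] `*` setT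
  end.

Definition triangle_count (p : 'I_M -> bool) (U V : side) (k : 'I_M) : nat :=
  #|[set ij : 'I_M * 'I_M |
      [&& p ij.1, p ij.2 & `[< triangle V ij.1 ij.2 `<=` column U k >]]]%SET|.

Definition side_of (a : 'I_2) : side := if a == 0 then Left else Right.

Definition count_mx (p : 'I_M -> bool) (k : 'I_M) : 'M[nat]_2 :=
  \matrix_(a < 2, b < 2) triangle_count p (side_of a) (side_of b) k.

End CountingMatrices.

(* A 2 x 2 matrix with entries in {0,1} is a boolean matrix (0 is false and
   1 is true).  Products are taken over nat: bool carries the ring structure
   of F_2 in MathComp, in which 1 + 1 = 0. *)
Definition reduce_mx (A : 'M[nat]_2) : 'M[bool]_2 :=
  map_mx (fun a : nat => (0 < a)%N) A.

Definition nat_mx (T : 'M[bool]_2) : 'M[nat]_2 := map_mx nat_of_bool T.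

Definition zero_mx01 : 'M[bool]_2 := const_mx false.

(* [mul_step finset.set0] is [finset.set0]. *)
Definition mul_step (C : {set 'M[bool]_2}) : {set 'M[bool]_2} :=
  [set reduce_mx (nat_mx T *m nat_mx T') | T in C, T' in C]%SET.

(* The orbit of C is constant from a fixed point on, so C determines A. *)
Definition reached_fixed_point (C A : {set 'M[bool]_2}) : Prop :=
  mul_step A = A /\ exists n : nat, A = iter n mul_step C.

Definition start_set (R : realType) (M : nat) (p : 'I_M -> bool) :
    {set 'M[bool]_2} :=
  [set reduce_mx (count_mx R p k) | k : 'I_M]%SET.

(* Main.v *)
Require Import Defs.
From mathcomp Require Import all_boot all_order all_algebra.
From mathcomp Require Import all_classical all_reals all_analysis.
From mathcomp Require Import ring lra zify.

Set Implicit Arguments.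
Unset Strict Implicit.
Unset Printing Implicit Defensive.

Import Order.TTheory GRing.Theory Num.Theory.
Import numFieldNormedType.Exports.

Local Open Scope classical_set_scope.
Local Open Scope ring_scope.

(** A difference [x2 - x1] of two points of the Cantor set is followed through
    its base [M] digits: [x1] and [x2] have expansions whose digits [i] satisfy
    [p i], and their first [n] digits form integers that differ by some [d].
    Call such a [d] attained at level [n] ([diff p n d]).  At level [n] the
    difference set is covered by the intervals [(d-1)/M^n, (d+1)/M^n] with [d]
    attained, so the column [K/M^n, (K+1)/M^n] is missed (up to its end points)
    exactly when neither [K] nor [K+1] is attained.

    The four entries of the boolean matrix [block p n K] say which of
    [K+1-M^n], [K-M^n], [K+1], [K] are attained; its rows belong to the two
    columns with number [K] in [-1, 0] and in [0, 1].  Splitting an [m+n]-digit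
    difference with a carry that can only be 0 or 1 ([diff_split]) shows that
    blocks multiply: the block of a concatenated digit string is the boolean
    product of the blocks ([block_mul]).  At level 1 the blocks are the reduced
    counting matrices ([reduce_count_mx]), so the [m]-th iterate of the starting
    set consists of the blocks of level [2^m] ([iter_start_set]), and the zero
    matrix belongs to the fixed point iff some block vanishes, since a vanishing
    block makes all its extensions vanish.

    If a block vanishes, it produces a gap inside every [M]-adic column: each
    interval contains a whole column, and appending the digits of the vanishing
    block to it gives a subcolumn missed by the difference set
    ([zero_block_no_interval]).  Conversely, assume that there is no interval.
    By compactness a column all of whose subcolumns meet the level covers would
    lie in the difference set ([covered_column]), so every column contains a
    missed subcolumn.  Choose one in [0, 1], which kills the second row of a
    block; the first row belongs to a column in [-1, 0], in which a further
    missed subcolumn can be chosen.  The block of the concatenated string has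
    both rows zero ([no_interval_zero_block]).

    That the orbit of the starting set becomes constant follows from an
    identity of boolean 2 x 2 matrices: [AB] is one of [AAAB], [ABAB], [ABBB]
    ([bool_mul_pump]).  Hence from the first step on the orbit increases, and it
    lives in a finite set. *)

(** * Boolean matrix products and the orbits of the squaring map *)

Definition bool_mul (A B : 'M[bool]_2) : 'M[bool]_2 :=
  reduce_mx (nat_mx A *m nat_mx B).

Lemma bool_mulE A B i j :
  bool_mul A B i j = (A i ord0 && B ord0 j) || (A i ord_max && B ord_max j).
Proof.
rewrite !mxE !big_ord_recl big_ord0 !mxE.
have -> : lift ord0 ord0 = ord_max :> 'I_2 by exact/val_inj.
by case: (A i ord0); case: (B ord0 j); case: (A i ord_max); case: (B ord_max j).
Qed.

Definition quad_mx (a b c d : bool) : 'M[bool]_2 :=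
  \matrix_(i, j) if i == ord0 then if j == ord0 then a else b
                 else if j == ord0 then c else d.

Lemma ord2P (i : 'I_2) : i = ord0 \/ i = ord_max.
Proof.
by case: i => [[|[|//]] Hi]; [left|right]; apply/val_inj.
Qed.

Lemma quad_mx_surj (A : 'M[bool]_2) :
  A = quad_mx (A ord0 ord0) (A ord0 ord_max) (A ord_max ord0) (A ord_max ord_max).
Proof.
apply/matrixP => i j; rewrite mxE.
by case: (ord2P i) => ->; case: (ord2P j) => ->.
Qed.

Lemma bool_mul_quad a b c d a' b' c' d' :
  bool_mul (quad_mx a b c d) (quad_mx a' b' c' d') =
  quad_mx (a && a' || b && c') (a && b' || b && d')
          (c && a' || d && c') (c && b' || d && d').
Proof.
apply/matrixP => i j; rewrite bool_mulE !mxE.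
by case: (ord2P i) => ->; case: (ord2P j) => ->.
Qed.

(** A boolean 2 x 2 matrix satisfies [A^3 = A] with four exceptions: the two
    nonzero nilpotent matrices and the two matrices whose only zero entry is on
    the diagonal.  So [AB] equals [AAAB] or [ABBB] unless both factors are
    exceptional, and the product of any two exceptional matrices is idempotent,
    which gives [AB = ABAB].  The proof runs through the 256 pairs. *)
Lemma bool_mul_pump A B :
  [\/ bool_mul A B = bool_mul (bool_mul A A) (bool_mul A B),
      bool_mul A B = bool_mul (bool_mul A B) (bool_mul A B) |
      bool_mul A B = bool_mul (bool_mul A B) (bool_mul B B)].
Proof.
rewrite (quad_mx_surj A) (quad_mx_surj B) !bool_mul_quad.
move: (A _ _) (A _ _) (A _ _) (A _ _) (B _ _) (B _ _) (B _ _) (B _ _).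
by move=> [] [] [] [] [] [] [] [];
  solve [constructor 1; reflexivity | constructor 2; reflexivity
        | constructor 3; reflexivity].
Qed.

Lemma mem_mul_step (C : {set 'M[bool]_2}) A B :
  A \in C -> B \in C -> bool_mul A B \in mul_step C.
Proof. by move=> AC BC; apply/imset2P; exists A B. Qed.

Lemma mul_stepP (C : {set 'M[bool]_2}) T :
  T \in mul_step C -> exists A B, [/\ A \in C, B \in C & T = bool_mul A B].
Proof. by case/imset2P => A B AC BC ->; exists A, B. Qed.

(** The three words of [bool_mul_pump] are products of two words of length 2.
    The inclusion of [C] itself in [mul_step C] may fail: the permutation matrix
    that exchanges the two indices has the identity as its square. *)
Lemma mul_step_incr (C : {set 'M[bool]_2}) :
  mul_step C \subset mul_step (mul_step C).
Proof.
apply/fintype.subsetP => _ /mul_stepP[A [B [AC BC ->]]].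
by case: (bool_mul_pump A B) => ->; do !apply: mem_mul_step.
Qed.

Lemma orbit_stabilizes (C : {set 'M[bool]_2}) :
  exists n, mul_step (iter n mul_step C) = iter n mul_step C.
Proof.
apply: contrapT => /forallNP nfix.
have big n : (n <= #|iter n.+1 mul_step C|)%N.
  elim: n => // n /leq_ltn_trans; apply; apply: proper_card.
  rewrite finset.properEneq [iter n.+2 _ _]iterS [iter n.+1 _ _]iterS mul_step_incr.
  by rewrite andbT eq_sym; apply/eqP/(nfix n.+1).
by have := leq_trans (big #|{: 'M[bool]_2}|.+1) (max_card _); rewrite ltnn.
Qed.

Lemma iter_fixed (T : Type) (g : T -> T) x m n :
  g (iter m g x) = iter m g x -> (m <= n)%N -> iter n g x = iter m g x.
Proof. by move=> fx /subnK <-; rewrite iterD iter_fix. Qed.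

(** * Digit expansions and attained differences *)

Lemma concat_lt a b A B : (a < A -> b < B -> a * B + b < A * B)%N.
Proof.
move=> aA bB; apply: (@leq_trans (a.+1 * B)%N).
  by rewrite mulSn addnC ltn_add2r.
by rewrite leq_mul2r aA orbT.
Qed.

Section Digits.
Variables (M : nat) (p : 'I_M -> bool).

(** Infinite digit sequences rather than strings: they restrict to every level
    and always determine a point of the Cantor set. *)
Definition admissible (f : nat -> 'I_M) : Prop := forall k, p (f k).

Fixpoint code (f : nat -> 'I_M) (n : nat) : nat :=
  if n is n'.+1 then (code f n' * M + f n')%N else 0%N.

Lemma code_cat f m n :
  code f (m + n) = (code f m * M ^ n + code (fun k => f (m + k)%N) n)%N.
Proof.
elim: n => [|n IHn]; first by rewrite !addn0 expn0 muln1.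
by rewrite addnS /= IHn expnSr mulnDl mulnA addnA.
Qed.

Lemma code_lt f n : (code f n < M ^ n)%N.
Proof.
elim: n => [|n IHn] //=; rewrite expnSr.
exact: concat_lt.
Qed.

Lemma eq_code f g n : (forall k, (k < n)%N -> f k = g k) -> code f n = code g n.
Proof.
elim: n => //= n IHn fg; rewrite fg // IHn // => k kn.
by apply: fg; rewrite ltnS ltnW.
Qed.

Definition diff (n : nat) (d : int) : Prop :=
  exists f g, [/\ admissible f, admissible g & d = (code f n)%:Z - (code g n)%:Z].

Lemma diff_cat m n (a b : int) :
  diff m a -> diff n b -> diff (m + n) (a * (M ^ n)%:Z + b).
Proof.
pose splice (f g : nat -> 'I_M) k := if (k < m)%N then f k else g (k - m)%N.
have adm f g : admissible f -> admissible g -> admissible (splice f g).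
  by move=> pf pg k; rewrite /splice; case: ifP.
have codeE f g : code (splice f g) (m + n) = (code f m * M ^ n + code g n)%N.
  rewrite code_cat; congr (_ * _ + _)%N.
    by apply: eq_code => k km; rewrite /splice km.
  by apply: eq_code => k _; rewrite /splice ltnNge leq_addr addKn.
move=> [f [g [pf pg ->]]] [f' [g' [pf' pg' ->]]].
exists (splice f f'), (splice g g'); split; [exact: adm|exact: adm|].
rewrite !codeE !PoszD !PoszM; ring.
Qed.

(** The last [n] digits contribute a difference strictly between [-M^n] and
    [M^n].  It is congruent to [r] modulo [M^n], so for [r] between [0] and [M^n]
    it is [r] or [r - M^n], and the carry [c] into the first [m] digits is 0
    or 1. *)
Lemma diff_split m n (j r : int) :
  0 <= r <= (M ^ n)%:Z -> diff (m + n) (j * (M ^ n)%:Z + r) ->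
  exists c : bool, diff m (j + c%:Z) /\ diff n (r - c%:Z * (M ^ n)%:Z).
Proof.
move=> rbnd [f [g [pf pg]]]; rewrite !code_cat.
set f' := fun k => _; set g' := fun k => _.
have := code_lt f' n; have := code_lt g' n.
move: (M ^ n)%N rbnd => B rbnd gB fB E.
pose e := (code f m)%:Z - (code g m)%:Z - j.
have Ee : e * B%:Z = r - ((code f' n)%:Z - (code g' n)%:Z).
  rewrite /e; move: E; rewrite !PoszD !PoszM; lia.
have e01 : e = 0 \/ e = 1 by nia.
exists (e == 1); split.
  exists f, g; split=> //; case: e01 => H; rewrite H /=; rewrite /e in H; lia.
exists f', g'; split; [by move=> k; apply: pf|by move=> k; apply: pg|].
by case: e01 => H; rewrite H /= in Ee *; lia.
Qed.

(** The reduced product of the counting matrices along the [n] digits of [K],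
    in closed form.  Row [ord0] belongs to the column numbered [K] in
    [-1, 0], the other row to its translate by 1 in [0, 1]; at column index [ord0] the attained
    difference is the right end point of the column, which is then covered by
    the left half of an interval of length [2/M^n] (a left triangle), and at
    the other index it is the left end point. *)
Definition block (n : nat) (K : nat) : 'M[bool]_2 :=
  \matrix_(a, b) `[< diff n (K%:Z + (b == ord0)%:Z - (a == ord0)%:Z * (M ^ n)%:Z) >].

Lemma blockP n K a b :
  reflect (diff n (K%:Z + (b == ord0)%:Z - (a == ord0)%:Z * (M ^ n)%:Z))
          (block n K a b).
Proof. by rewrite mxE; apply: asboolP. Qed.

(** The summation index of the matrix product is the carry of [diff_split]:
    the entries with index [ord0] correspond to carry 1. *)
Lemma block_mul m n K K' : (K' < M ^ n)%N ->
  block (m + n) (K * M ^ n + K') = bool_mul (block m K) (block n K').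
Proof.
move=> K'lt; apply/matrixP => a b; rewrite bool_mulE.
(* The difference of an entry of the product, cut with carry [c]. *)
have shape (c : bool) : (K * M ^ n + K')%N%:Z + (b == ord0)%:Z
    - (a == ord0)%:Z * (M ^ (m + n))%:Z =
  (K%:Z - (a == ord0)%:Z * (M ^ m)%:Z + c%:Z) * (M ^ n)%:Z
  + (K'%:Z + (b == ord0)%:Z - c%:Z * (M ^ n)%:Z).
  by rewrite expnD !PoszD !PoszM; ring.
apply/blockP/idP => [|].
  rewrite (shape false) /= mul0r addr0 subr0 => /diff_split[].
    by case: (b == ord0); move: (M ^ n)%N K'lt => B; lia.
  case=> -[d1 d2]; apply/orP; [left|right]; apply/andP; split; apply/blockP.
  - by move: d1; rewrite eqxx /= addrAC.
  - by move: d2; rewrite eqxx.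
  - by move: d1; rewrite /= addrAC.
  - by move: d2; rewrite /=.
case/orP => /andP[/blockP d1 /blockP d2].
  rewrite (shape true); apply: diff_cat; last exact: d2.
  by move: d1; rewrite /= addrAC.
rewrite (shape false); apply: diff_cat; last exact: d2.
by move: d1; rewrite /= addrAC.
Qed.

End Digits.

(** * The counting matrices *)
Section Geometry.
Variables (R : realType) (M : nat).
Hypothesis M_gt0 : (0 < M)%N.

Definition is_left (V : side) : bool := if V is Left then true else false.

Lemma level1P (i : 'I_M) (x : R) :
  level1 i x <-> i%:R <= x * M%:R <= i%:R + 1.
Proof.
have M0 : (0 : R) < M%:R by rewrite ltr0n.
rewrite /level1 /cyl /cyl_left big_ord1 (tnth_nth i) /= expr1 in_itv /=.
by rewrite -[X in _ + X]mul1r -mulrDl ler_pdivrMr // ler_pdivlMr.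
Qed.

Lemma columnP (U : side) (k : 'I_M) (q : R * R) :
  column U k q <->
  k%:R - (is_left U)%:R * M%:R <= q.1 * Num.sqrt 2 * M%:R
                               <= k%:R + 1 - (is_left U)%:R * M%:R.
Proof.
have s0 : (0 : R) < Num.sqrt 2 by rewrite sqrtr_gt0.
have s2 : Num.sqrt 2 * Num.sqrt 2 = 2 :> R by rewrite -expr2 sqr_sqrtr.
have halfE (x : R) : Num.sqrt 2 / 2 * x * Num.sqrt 2 = x.
  have -> : Num.sqrt 2 / 2 * x * Num.sqrt 2 = Num.sqrt 2 * Num.sqrt 2 / 2 * x.
    by ring.
  by rewrite s2 divff ?mul1r ?pnatr_eq0.
have cancel (x y : R) : x * Num.sqrt 2 = y * Num.sqrt 2 -> x = y.
  by apply: mulIf; rewrite gt_eqF.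
case: U => /=; split.
- move=> [[x /level1P xk <-] _]; rewrite mulrBl halfE.
  have := halfE 1; rewrite mulr1 => ->; rewrite mulrBl mul1r; lra.
- move=> H; split=> //; exists (q.1 * Num.sqrt 2 + 1).
    by apply/level1P; rewrite mulrDl mul1r; lra.
  apply: cancel; rewrite mulrBl halfE.
  by have := halfE 1; rewrite mulr1 => ->; rewrite addrK.
- by move=> [[x /level1P xk <-] _]; rewrite halfE mul0r !subr0.
- rewrite mul0r !subr0 => H; split=> //; exists (q.1 * Num.sqrt 2).
    exact/level1P.
  by apply: cancel; rewrite halfE.
Qed.

Lemma rot_fst (q : R * R) : (Defs.rot q).1 * Num.sqrt 2 = q.1 - q.2.
Proof. by rewrite /= divfK // gt_eqF // sqrtr_gt0. Qed.

Lemma triangleP (V : side) (i j : 'I_M) (q : R * R) :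
  triangle V i j q <->
  exists x y, [/\ i%:R <= x * M%:R <= i%:R + 1, j%:R <= y * M%:R <= j%:R + 1,
    q = Defs.rot (x, y) &
    if is_left V then (x - y) * M%:R <= i%:R - j%:R
    else i%:R - j%:R <= (x - y) * M%:R].
Proof.
have M0 : (0 : R) < M%:R by rewrite ltr0n.
have s0 : (0 : R) < Num.sqrt 2 by rewrite sqrtr_gt0.
have diag (x y : R) :
  ((Defs.rot (x, y)).1 <= (bottom_vertex R i j).1) =
    ((x - y) * M%:R <= i%:R - j%:R) /\
  ((bottom_vertex R i j).1 <= (Defs.rot (x, y)).1) =
    (i%:R - j%:R <= (x - y) * M%:R).
  rewrite /bottom_vertex /= !ler_pM2r ?invr_gt0 //.
  rewrite /cyl_left !big_ord1 (tnth_nth i) (tnth_nth j) /= expr1.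
  by rewrite -mulrBl ler_pdivlMr // ler_pdivrMr.
split.
  case: V => -[] [[x y] [/= /level1P xi /level1P yj <-]] /=;
    case: (diag x y) => d1 d2; rewrite ?d1 ?d2 => H; by exists x, y.
move=> [x [y [xi yj -> H]]].
have sq : square i j (Defs.rot (x, y)).
  by exists (x, y) => //; split; apply/level1P.
by case: (diag x y) => d1 d2; case: V H => /= H; split=> //=; rewrite ?d1 ?d2.
Qed.

(** Multiplied by the square root of 2, the first coordinate of a point of the
    triangle is a difference [x - y], which fills exactly one of the two halves
    of [(i-j-1)/M, (i-j+1)/M].  Testing the corners of the square shows that
    this half must be the column. *)
Lemma triangle_subP (U V : side) (i j k : 'I_M) :
  triangle V i j `<=` @column R M U k <->
  (i%:Z - j%:Z = k%:Z + (is_left V)%:Z - (is_left U)%:Z * M%:Z).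
Proof.
have M0 : (0 : R) < M%:R by rewrite ltr0n.
have toR : (i%:Z - j%:Z = k%:Z + (is_left V)%:Z - (is_left U)%:Z * M%:Z) <->
  (i%:R - j%:R = k%:R + (is_left V)%:R - (is_left U)%:R * M%:R :> R).
  split=> [H|H].
    have := congr1 (fun z : int => z%:~R : R) H.
    by rewrite !(rmorphB, rmorphD, rmorphM) /= -!pmulrn.
  apply/eqP; rewrite -(eqr_int R).
  by rewrite !(rmorphB, rmorphD, rmorphM) /= -!pmulrn; apply/eqP.
rewrite toR; split=> [sub|E q]; last first.
  move=> /triangleP[x [y [xi yj -> H]]]; apply/columnP; rewrite rot_fst /=.
  by case: V E H {toR} => /=; rewrite mulrBl; lra.
have mem (x y : R) : i%:R <= x <= i%:R + 1 -> j%:R <= y <= j%:R + 1 ->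
    (if is_left V then x - y <= i%:R - j%:R else i%:R - j%:R <= x - y) ->
    k%:R - (is_left U)%:R * M%:R <= x - y <= k%:R + 1 - (is_left U)%:R * M%:R.
  move=> xi yj xy; have MV z : z / M%:R * M%:R = z :> R by rewrite divfK ?gt_eqF.
  have /sub/columnP : triangle V i j (Defs.rot (x / M%:R, y / M%:R)).
    by apply/triangleP; exists (x / M%:R), (y / M%:R); rewrite -mulrBl !MV.
  by rewrite rot_fst /= -mulrBl MV.
(* In the coordinates scaled by [M]: the bottom vertex, and the corners where
   [x - y] is smallest and largest. *)
have /= := mem i%:R j%:R; have := mem i%:R (j%:R + 1).
have := mem (i%:R + 1) j%:R; case: V {sub mem toR} => /=; lra.
Qed.

End Geometry.

(** * Iterates of the starting set *)
Section Words.
Variables (R : realType) (M : nat) (p : 'I_M -> bool).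

Lemma diff1P d :
  diff p 1 d <-> exists i j : 'I_M, [/\ p i, p j & d = i%:Z - j%:Z].
Proof.
split=> [[f [g [pf pg ->]]]|[i [j [pi pj ->]]]].
  by exists (f 0%N), (g 0%N); split; [exact: pf|exact: pg|].
by exists (fun=> i), (fun=> j); split=> // k.
Qed.

Lemma reduce_count_mx (k : 'I_M) : reduce_mx (count_mx R p k) = block p 1 k.
Proof.
have M_gt0 : (0 < M)%N by exact: leq_ltn_trans (ltn_ord k).
apply/matrixP => a b.
have sideE (c : 'I_2) : (c == ord0) = is_left (side_of c).
  by case: (ord2P c) => ->.
rewrite !mxE !sideE expn1; apply/card_gt0P/asboolP => [[[i j]]|].
  rewrite finset.inE /= => /and3P[pi pj /asboolP/triangle_subP-/(_ M_gt0) ij].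
  by apply/diff1P; exists i, j.
move=> /diff1P[i [j [pi pj ij]]]; exists (i, j); rewrite finset.inE /= pi pj /=.
by apply/asboolP/triangle_subP.
Qed.

(** Squaring a set of matrices doubles the length of the words, and a number
    below [M^(2n)] is a pair of numbers below [M^n]. *)
Lemma iter_start_set m (T : 'M[bool]_2) :
  T \in iter m mul_step (start_set R p) <->
  exists2 K, (K < M ^ (2 ^ m))%N & T = block p (2 ^ m) K.
Proof.
elim: m T => [|m IHm] T.
  rewrite expn0 expn1; split=> [/imsetP[k _ ->]|[K KM ->]].
    by exists k; rewrite ?ltn_ord // reduce_count_mx.
  by apply/imsetP; exists (Ordinal KM); rewrite ?reduce_count_mx.
rewrite iterS expnS mul2n -addnn; set n := (2 ^ m)%N in IHm *.
split=> [/mul_stepP[_ [_ [/IHm[K KM ->] /IHm[K' K'M ->] ->]]]|[K KM ->]].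
  exists (K * M ^ n + K')%N; last by rewrite block_mul.
  by rewrite expnD concat_lt.
have Mn_gt0 : (0 < M ^ n)%N by move: KM; rewrite expnD; case: (M ^ n)%N.
rewrite (divn_eq K (M ^ n)) block_mul ?ltn_mod //; apply: mem_mul_step.
  by apply/IHm; exists (K %/ M ^ n)%N; rewrite // ltn_divLR // -expnD.
by apply/IHm; exists (K %% M ^ n)%N; rewrite // ltn_mod.
Qed.

Lemma zero_block_extend n K m : (0 < M)%N ->
  block p n K = zero_mx01 -> block p (n + m) (K * M ^ m) = zero_mx01.
Proof.
move=> M_gt0 Z; rewrite -[(K * _)%N]addn0 block_mul ?expn_gt0 ?M_gt0 // Z.
by apply/matrixP => a b; rewrite bool_mulE !mxE.
Qed.

End Words.

(** * Points of the Cantor set *)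
Section CantorPoints.
Variables (R : realType) (M : nat) (p : 'I_M -> bool) (i0 : 'I_M).
Hypotheses (M_gt1 : (1 < M)%N) (p_i0 : p i0).

Local Notation B n := ((M ^ n)%N%:R : R).

Lemma expM_gt0 n : 0 < B n.
Proof. by rewrite ltr0n expn_gt0 ltnW. Qed.

Lemma cyl_left_code (f : nat -> 'I_M) n :
  cyl_left R [tuple f k | k < n] = (code f n)%:R / B n.
Proof.
have -> : cyl_left R [tuple f k | k < n] = \sum_(k < n) (f k)%:R / M%:R ^+ k.+1.
  by apply: eq_bigr => k _; rewrite tnth_mktuple.
elim: n => [|n IHn]; first by rewrite big_ord0 mul0r.
rewrite big_ord_recr /= IHn natrD mulrDl expnSr !natrM natrX -exprSr.
by rewrite exprSr -mulf_div divff ?mulr1 // pnatr_eq0 -lt0n ltnW.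
Qed.

Lemma cyl_codeP (f : nat -> 'I_M) n (x : R) :
  cyl R [tuple f k | k < n] x <->
  (code f n)%:R <= x * B n <= (code f n)%:R + 1.
Proof.
rewrite /cyl cyl_left_code /= in_itv /= -natrX.
by rewrite -[X in _ + X]mul1r -mulrDl ler_pdivrMr ?ler_pdivlMr ?expM_gt0.
Qed.

(** The sequence [f] may change with [n]: at a point shared by two intervals of
    a level, either expansion can serve. *)
Lemma cantor_setP (x : R) :
  cantor_set01 R p x <->
  forall n, (0 < n)%N -> exists2 f, admissible p f &
    (code f n)%:R <= x * B n <= (code f n)%:R + 1.
Proof.
split=> [Fx n n0|Fx n /= n0].
  have [s ps sx] := Fx n n0.
  exists (fun k => nth i0 s k).
    move=> k; have [kn|nk] := ltnP k n; last by rewrite nth_default ?size_tuple.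
    by have := ps (Ordinal kn); rewrite (tnth_nth i0).
  apply/cyl_codeP; congr (cyl _ _ _): sx; apply: eq_from_tnth => k.
  by rewrite tnth_mktuple (tnth_nth i0).
have [f pf /cyl_codeP fx] := Fx n n0.
by exists [tuple f k | k < n] => // k; rewrite tnth_mktuple.
Qed.

(** The level intervals of one sequence are nested, so the supremum of their
    left end points lies in all of them. *)
Lemma admissible_point (f : nat -> 'I_M) : admissible p f ->
  exists2 x, cantor_set01 R p x &
    forall n, (code f n)%:R <= x * B n <= (code f n)%:R + 1.
Proof.
move=> pf.
pose lo n := (code f n)%:R / B n; pose hi n := ((code f n)%:R + 1) / B n.
have lohi m n : lo m <= hi n.
  rewrite /lo /hi ler_pdivrMr ?expM_gt0 // mulrAC ler_pdivlMr ?expM_gt0 //.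
  rewrite natr1 -!natrM ler_nat.
  have [/subnKC <-|/ltnW/subnKC <-] := leqP m n; rewrite code_cat expnD.
    move: (code _ (_ - _)) => c; set a := code f m.
    by rewrite mulSn; nia.
  set g := fun k => _; have := code_lt g (m - n).
  move: (code g _) (M ^ (m - n))%N => c b cb; nia.
have lo_sup : has_sup (range lo).
  split; first by exists (lo 0%N), 0%N.
  by exists (hi 0%N) => _ [m _ <-].
have xP n : (code f n)%:R <= sup (range lo) * B n <= (code f n)%:R + 1.
  apply/andP; split.
    rewrite -ler_pdivrMr ?expM_gt0 //.
    by apply: ub_le_sup; [exact: lo_sup.2|exists n].
  rewrite -ler_pdivlMr ?expM_gt0 //.
  by apply: ge_sup => [|_ [m _ <-]]; [exact: lo_sup.1|exact: lohi].
exists (sup (range lo)) => //.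
by apply/cantor_setP => n _; exists f.
Qed.

Lemma cantor_compact : compact (cantor_set01 R p).
Proof.
apply: (@subclosed_compact R _ `[0%R, 1%R]%classic).
- apply: closed_bigI => n _; apply: closed_bigcup => [|s _].
    exact: finite_finset.
  exact: itv_closed.
- exact: segment_compact.
move=> x /cantor_setP/(_ 1%N isT)[f _]; rewrite /= in_itv /= expn1.
have := code_lt f 1; rewrite expn1 -(ltr_nat R) => fM /andP[x0 x1].
have M0 : (0 : R) < M%:R by rewrite ltr0n ltnW.
have f0 : (0 : R) <= (code f 1)%:R by [].
have fM1 : (code f 1)%:R + 1 <= M%:R :> R.
  by rewrite natr1 ler_nat -(ltr_nat R).
apply/andP; split; first by rewrite -(pmulr_lge0 _ M0) (le_trans f0).
by rewrite -(ler_pM2r M0) mul1r (le_trans x1).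
Qed.

(** * Intervals in the difference set *)

Local Notation FF :=
  (algebraic_difference (cantor_set01 R p) (cantor_set01 R p)).

Lemma difference_closed : closed FF.
Proof.
have -> : FF = (fun z : R * R => z.1 - z.2) @`
                 (cantor_set01 R p `*` cantor_set01 R p).
  apply/seteqP; split=> [_ [x Fx [y Fy <-]]|_ [[x y] [Fx Fy] <-]].
    by exists (x, y).
  by exists x => //; exists y.
apply: compact_closed; first exact: Rhausdorff.
apply: continuous_compact; last exact: compact_setX cantor_compact cantor_compact.
by apply: continuous_subspaceT; exact: sub_continuous.
Qed.

Lemma difference_diff n (t : R) : (0 < n)%N -> FF t ->
  exists2 d, diff p n d & d%:~R - 1 <= t * B n <= d%:~R + 1.
Proof.
move=> n0 [x /cantor_setP/(_ n n0)[f pf fx] [y /cantor_setP/(_ n n0)[g pg gy] <-]].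
exists ((code f n)%:Z - (code g n)%:Z); first by exists f, g.
by rewrite intrB -!pmulrn mulrBl; lra.
Qed.

Lemma diff_difference n d : diff p n d ->
  exists2 t, FF t & d%:~R - 1 <= t * B n <= d%:~R + 1.
Proof.
move=> [f [g [/admissible_point[x Fx /(_ n) fx]]]].
move=> /admissible_point[y Fy /(_ n) gy] ->.
exists (x - y); first by exists x => //; exists y.
by rewrite intrB -!pmulrn mulrBl; lra.
Qed.

(** For each [m] a point [t] of the column lies in a subcolumn of level [n + m]
    one of whose end points is attained, hence within [2/M^(n+m)] of a point of
    the difference set, which is closed. *)
Lemma covered_column n (j : int) :
  (forall m K, (K < M ^ m)%N ->
     diff p (n + m) (j * (M ^ m)%:Z + K%:Z) \/
     diff p (n + m) (j * (M ^ m)%:Z + K.+1%:Z)) ->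
  `[j%:~R / B n, (j + 1)%:~R / B n[ `<=` FF.
Proof.
move=> cov t /=; rewrite in_itv /= ler_pdivrMr ?ltr_pdivlMr ?expM_gt0 // intrD.
move=> /andP[jt tj].
apply: difference_closed => U /nbhs_ballP[e /= e0 eU].
pose m := Num.truncn (2 / e).
have m_e : 2 < e * B (n + m).
  have /andP[_ lt_m] := truncn_itv (ltW (divr_gt0 (ltr0Sn R 1) e0) : 0 <= 2 / e :> R).
  rewrite mulrC -ltr_pdivrMr //; apply: (lt_le_trans lt_m).
  rewrite ler_nat; apply: (leq_trans (ltn_expl m M_gt1)).
  by rewrite leq_exp2l // leq_addl.
pose u := t * B n - j%:~R.
have u_ge0 : 0 <= u * B m by apply: mulr_ge0; rewrite ?subr_ge0.
pose K := Num.truncn (u * B m).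
have /andP[Ku uK] : K%:R <= u * B m < K.+1%:R := truncn_itv u_ge0.
have KM : (K < M ^ m)%N.
  rewrite -(ltr_nat R); apply: (le_lt_trans Ku).
  by rewrite gtr_pMl ?expM_gt0 // /u; lra.
have [d Dd dt] : exists2 d, diff p (n + m) d &
    d%:~R - 1 <= t * B (n + m) <= d%:~R + 1.
  have tB : t * B (n + m) = j%:~R * B m + u * B m.
    by rewrite expnD natrM /u; ring.
  case: (cov m K KM) => Dd; [exists (j * (M ^ m)%:Z + K%:Z)|
                             exists (j * (M ^ m)%:Z + K.+1%:Z)] => //;
  rewrite tB intrD intrM -!pmulrn; move: uK; rewrite -natr1; lra.
have [s Fs ds] := diff_difference Dd.
exists s; split=> //; apply: eU; rewrite /ball /= ltr_norml.
rewrite -[_ < t - s](ltr_pM2r (expM_gt0 (n + m))).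
rewrite -[t - s < _](ltr_pM2r (expM_gt0 (n + m))).
by rewrite mulrBl mulNr; lra.
Qed.

Lemma uncovered_subcolumn n (j : int) :
  ~ contains_interval FF ->
  exists m K, [/\ (K < M ^ m)%N, ~ diff p (n + m) (j * (M ^ m)%:Z + K%:Z) &
    ~ diff p (n + m) (j * (M ^ m)%:Z + K.+1%:Z)].
Proof.
move=> noint; apply: contrapT => /forallNP none; apply: noint.
exists `[j%:~R / B n, (j + 1)%:~R / B n[%classic; split.
- exact: interval_is_interval.
- exists (j%:~R / B n), ((j%:~R + 1 / 2) / B n); rewrite /= !in_itv /= lexx /=.
  rewrite !ler_pM2r ?ltr_pM2r ?invr_gt0 ?expM_gt0 // intrD.
  by split; lra.
apply: covered_column => m K KM; apply: contrapT => /not_orP[D1 D2].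
by have /forallNP/(_ K) := none m; apply.
Qed.

(** An interval contains a column [j/M^m, (j+1)/M^m].  The centre of its
    subcolumn number [K] of level [m + n] is not in the difference set: if an
    end point of the subcolumn were attained, [diff_split] would give a true
    entry of the vanishing block, in the row decided by the carry into the
    digits of [j]. *)
Lemma zero_block_no_interval n K : (K < M ^ n)%N ->
  block p n K = zero_mx01 -> ~ contains_interval FF.
Proof.
move=> KM Z [J [Jitv [x [y [Jx Jy xy]]] JFF]].
pose m := (Num.truncn (2 / (y - x))).+1.
have m_xy : 2 < (y - x) * B m.
  have d0 : 0 < y - x by rewrite subr_gt0.
  have /andP[_ lt_m] :=
    truncn_itv (ltW (divr_gt0 (ltr0Sn R 1) d0) : 0 <= 2 / (y - x) :> R).
  rewrite mulrC -ltr_pdivrMr //; apply: (lt_le_trans lt_m).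
  by rewrite ler_nat ltnW // ltn_expl.
have [j [xj jx]] : exists j : int, x * B m < j%:~R /\ j%:~R <= x * B m + 1.
  have /andP[jx xj] := floor_itv (x * B m).
  by exists (Num.floor (x * B m) + 1); rewrite intrD lerD2r -intrD.
(* The centre of the subcolumn, because in units of [M^-(m+n)] its two end
   points are the only integers at distance at most 1 from it. *)
pose v := (K%:R + 1 / 2) / B n : R.
have v_gt0 : 0 < v by rewrite divr_gt0 ?expM_gt0 // addr_gt0 // ltr_wpDl.
have v_lt1 : v < 1.
  rewrite ltr_pdivrMr ?expM_gt0 // !mul1r.
  by apply: (@lt_le_trans _ _ K.+1%:R); rewrite ?ler_nat // -(natr1 K); lra.
pose t := (j%:~R + v) / B m.
have tB : t * B m = j%:~R + v by rewrite divfK // gt_eqF ?expM_gt0.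
have Ft : FF t.
  apply/JFF/(Jitv x y) => //.
  rewrite -(ler_pM2r (expM_gt0 m)) -[t <= _](ler_pM2r (expM_gt0 m)) tB.
  by move: m_xy; rewrite mulrBl; lra.
have [d Dd] := difference_diff (ltn_addr n (ltn0Sn _) : (0 < m + n)%N) Ft.
have -> : t * B (m + n) = (j * (M ^ n)%:Z + K%:Z)%:~R + 1 / 2.
  rewrite expnD natrM mulrA tB mulrDl divfK ?gt_eqF ?expM_gt0 //.
  by rewrite intrD intrM -!pmulrn; ring.
move=> dt.
have [b dE] : exists b : bool, d = j * (M ^ n)%:Z + (K%:Z + b%:Z).
  set a := j * (M ^ n)%:Z + K%:Z in dt.
  have d_lo : d < a + 2 by rewrite -(ltr_int R) intrD; lra.
  have d_hi : a - 1 < d by rewrite -(ltr_int R) intrB; lra.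
  suff [b dE] : exists b : bool, d = a + b%:Z by exists b; rewrite dE /a addrA.
  move: a d_lo d_hi {dt}; clear=> a d_lo d_hi.
  by exists (d == a + 1); case: eqVneq => /=; lia.
move: Dd; rewrite dE => /diff_split[].
  by move: KM; clear; case: b => /=; lia.
move=> c [_ Dc].
suff : block p n K (if c then ord0 else ord_max) (if b then ord0 else ord_max).
  by rewrite Z mxE.
by apply/blockP; case: b c {dE} Dc => [] [].
Qed.

(** The two rows of a block are treated one after the other.  The first missed
    subcolumn is chosen in [0, 1]; the second one inside the column in [-1, 0]
    with the same digits, and extending the digits keeps the first one
    missed. *)
Lemma no_interval_zero_block :
  ~ contains_interval FF ->
  exists n K, (K < M ^ n)%N /\ block p n K = zero_mx01.
Proof.
move=> noint.
have [m [K [KM D0 D1]]] := uncovered_subcolumn 0 0 noint.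
rewrite add0n mul0r !add0r in D0 D1.
have [n [K' [KM' D0' D1']]] :=
  uncovered_subcolumn m (K%:Z - (M ^ m)%:Z) noint.
exists (m + n)%N, (K * M ^ n + K')%N; split.
  by rewrite expnD concat_lt.
apply/matrixP => a b; rewrite [RHS]mxE; apply/negP => /blockP.
(* The first row is missed by the choice of [K'], the second one already by
   the choice of [K]. *)
have [->|->] := ord2P a; rewrite /= ?mul0r ?subr0 ?mul1r ?expnD PoszD !PoszM.
  have -> : K%:Z * (M ^ n)%:Z + K'%:Z + (b == ord0)%:Z - (M ^ m)%:Z * (M ^ n)%:Z
    = (K%:Z - (M ^ m)%:Z) * (M ^ n)%:Z + (K' + (b == ord0))%N%:Z.
    by rewrite PoszD; ring.
  by case: (b == ord0); rewrite ?addn1 ?addn0.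
rewrite -addrA => /diff_split[]; first by move: (M ^ n)%N KM'; case: eqP; lia.
case=> -[Dm _]; last by apply: D0; move: Dm; rewrite addr0.
by apply: D1; rewrite -[K.+1]addn1 PoszD.
Qed.

End CantorPoints.

Theorem theorem2 (R : realType) (M : nat) (p : 'I_M -> bool)
    (F1 F2 : set R) :
  (2 <= M)%N ->
  (1 < \sum_(k < M) p k)%N ->
  F1 = cantor_set01 R p -> F2 = cantor_set01 R p ->
  exists A : {set 'M[bool]_2},
    reached_fixed_point (start_set R p) A /\
    (~ contains_interval (algebraic_difference F2 F1) <-> zero_mx01 \in A).
Proof.
move=> M_gt1 p_gt1 -> ->.
have [i0 p_i0] : exists i0, p i0.
  apply: contrapT => /forallNP pF; move: p_gt1; rewrite big1 // => k _.
  by apply/eqP; rewrite eqb0; apply/negP/pF.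
have [m0 fixed] := orbit_stabilizes (start_set R p).
exists (iter m0 mul_step (start_set R p)); split; first by split; last exists m0.
split=> [/(no_interval_zero_block M_gt1 p_i0)[n [K [KM Z]]]|]; last first.
  move=> /iter_start_set[K KM Z].
  exact: (zero_block_no_interval M_gt1 p_i0 KM).
rewrite -(iter_fixed fixed (leq_maxl m0 n)).
have nm : (n <= 2 ^ maxn m0 n)%N.
  by rewrite (leq_trans (leq_maxr m0 n)) // ltnW // ltn_expl.
apply/iter_start_set; set N := (2 ^ _)%N in nm *.
exists (K * M ^ (N - n))%N.
  by rewrite -[X in (_ < M ^ X)%N](subnKC nm) expnD ltn_pmul2r // expn_gt0 ltnW.
by rewrite -[X in block p X _](subnKC nm) zero_block_extend // ltnW.
Qed.
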